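(* Let $\gamma\in(0,4)$ and let $\kappa>\max\{4/\gamma-1,\ \gamma/(4-\gamma)\}$. Consider the problem of minimizing over $x=(x_{(1)},x_{(2)})\in\mathbb{R}^2$ the quadratic $$q(x)=\frac{\kappa}{2}x_{(1)}^2+\frac12 x_{(2)}^2,$$ whose minimal value is $q^\star=0$. Suppose the initial point $x^0=(x^0_{(1)},x^0_{(2)})\neq 0$ satisfies $$(x^0_{(2)})^2=\frac{4\kappa^2-\gamma\kappa(\kappa+1)}{\gamma(\kappa+1)-4}\,(x^0_{(1)})^2 .$$ Then the sequence $\{x^k\}$ generated by $\gamma$-PolyakGD applied to $q$ from $x^0$ satisfies, for all $k\ge 0$, $$\left|\frac{x^{k+1}_{(1)}}{x^k_{(1)}}\right|=\left|\frac{x^{k+1}_{(2)}}{x^k_{(2)}}\right|=\frac{\kappa-1}{\kappa+1}\qquad\text{and}\qquad q(x^k)-q^\star=\Big(\frac{\kappa-1}{\kappa+1}\Big)^{2k}\big(q(x^0)-q^\star\big).$$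
   Context: For a differentiable convex function $f$ with minimal value $f^\star$ and a parameter $\gamma>0$, $\gamma$-PolyakGD is the iteration $x^{k+1}=x^k-\gamma\,\alpha_k\nabla f(x^k)$ with Polyak stepsize $\alpha_k=\dfrac{f(x^k)-f^\star}{\|\nabla f(x^k)\|^2}$, $k=0,1,\dots$ ($\|\cdot\|$ is the Euclidean norm; if $\nabla f(x^k)=0$ the iteration stays at $x^k$). Subscripts in parentheses denote coordinates. *)

(* Defs.v *)
From HB Require Import structures.
From mathcomp Require Import all_boot all_order all_algebra.
From mathcomp Require Import all_classical all_reals all_analysis.

Set Implicit Arguments.
Unset Strict Implicit.
Unset Printing Implicit Defensive.

Import Order.TTheory GRing.Theory Num.Theory.
Import numFieldNormedType.Exports.
Local Open Scope classical_set_scope.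
Local Open Scope ring_scope.

(* The library norm `|x| on 'rV[R]_n is the sup norm, hence this definition. *)
Definition enorm (R : realType) (n : nat) (x : 'rV[R]_n) : R :=
  Num.sqrt (\sum_(i < n) x 0 i ^+ 2).

(* 'D_v f x is total: this is the gradient of f only where f is
   differentiable. *)
Definition gradient (R : realType) (n : nat) (f : 'rV[R]_n -> R)
    (x : 'rV[R]_n) : 'rV[R]_n :=
  \row_(i < n) 'D_(delta_mx 0 i) f x.

Definition is_min_value (R : realType) (T : Type) (f : T -> R) (m : R) : Prop :=
  range f m /\ lbound (range f) m.

Definition polyak_stepsize (R : realType) (n : nat) (f : 'rV[R]_n -> R)
    (fstar : R) (x : 'rV[R]_n) : R :=
  (f x - fstar) / enorm (gradient f x) ^+ 2.

Definition polyakGD_step (R : realType) (n : nat) (gamma : R)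
    (f : 'rV[R]_n -> R) (fstar : R) (x : 'rV[R]_n) : 'rV[R]_n :=
  if gradient f x == 0 then x
  else x - (gamma * polyak_stepsize f fstar x) *: gradient f x.

(* fstar is meant to be the minimal value of f, see is_min_value. *)
Definition polyakGD (R : realType) (n : nat) (gamma : R)
    (f : 'rV[R]_n -> R) (fstar : R) (x0 : 'rV[R]_n) (k : nat) : 'rV[R]_n :=
  iter k (polyakGD_step gamma f fstar) x0.

(* Coordinates (1) and (2) are the indices 0 and 1 of 'I_2. *)
Definition quad (R : realType) (kappa : R) (x : 'rV[R]_2) : R :=
  kappa / 2 * x 0 0 ^+ 2 + 1 / 2 * x 0 1 ^+ 2.

(* Main.v *)
Require Import Defs.
From HB Require Import structures.
From mathcomp Require Import all_boot all_order all_algebra.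
From mathcomp Require Import all_classical all_reals all_analysis.
From mathcomp Require Import ring lra.

Set Implicit Arguments.
Unset Strict Implicit.
Unset Printing Implicit Defensive.

Import Order.TTheory GRing.Theory Num.Theory.
Import numFieldNormedType.Exports.
Local Open Scope ring_scope.

(* On the cone x_2^2 = c x_1^2 with the given slope c, the scaled stepsize
   gamma * alpha equals the constant 2 / (kappa + 1). One step therefore
   multiplies x_1 by - rho and x_2 by rho, where
   rho = (kappa - 1) / (kappa + 1); in particular the cone is invariant and the
   k-th iterate is ((- rho)^k x_1, rho^k x_2). *)

Lemma is_derive_coord (R : realType) (m n : nat) (i : 'I_m) (j : 'I_n)
    (x v : 'M[R]_(m, n)) :
  is_derive x v (fun y : 'M[R]_(m, n) => y i j) (v i j).
Proof.
apply: DeriveDef; first exact/diff_derivable/differentiable_coord.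
(* The value is read off the derivative of the identity, since matrix-valued maps are derived
   entrywise. *)
have /matrixP/(_ i j) : 'D_v (@idfun 'M[R]_(m, n)) x = v by exact: derive_id.
by rewrite derive_mx ?mxE //; exact: derivable_id.
Qed.

Lemma derive_quad (R : realType) (kappa : R) (x v : 'rV[R]_2) :
  'D_v (quad kappa) x = kappa * x 0 0 * v 0 0 + x 0 1 * v 0 1.
Proof.
have d0 := is_derive_coord 0 0 x v; have d1 := is_derive_coord 0 1 x v.
have d := is_deriveD (is_deriveZ (kappa / 2) (is_deriveX 2 d0))
                     (is_deriveZ (1 / 2) (is_deriveX 2 d1)).
have := @derive_val _ _ _ _ _ _ _ d.
rewrite (_ : (_ + _)%R = quad kappa).
  by move=> ->; rewrite /GRing.scale /=; field.
by apply/funext => y.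
Qed.

Lemma gradient_quad (R : realType) (kappa : R) (x : 'rV[R]_2) :
  gradient (quad kappa) x = \row_i (if i == 0 then kappa * x 0 0 else x 0 1).
Proof.
apply/rowP => i; rewrite !mxE derive_quad !mxE eqxx /=.
by case: i => -[|[|//]] /= p; rewrite !(mulr0, mulr1, add0r, addr0).
Qed.

Lemma sqr_enorm (R : realType) (n : nat) (x : 'rV[R]_n) :
  enorm x ^+ 2 = \sum_(i < n) x 0 i ^+ 2.
Proof. by rewrite sqr_sqrtr // sumr_ge0 // => i _; exact: sqr_ge0. Qed.

Lemma quad_min_value (R : realType) (kappa : R) :
  0 <= kappa -> is_min_value (quad kappa) 0.
Proof.
move=> k0; split; first by exists 0 => //; rewrite /quad !mxE; ring.
move=> _ [x _ <-]; rewrite /quad.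
by rewrite addr_ge0 // mulr_ge0 ?sqr_ge0 // divr_ge0.
Qed.

Lemma polyakGD_step_quad (R : realType) (gamma kappa : R) (x : 'rV[R]_2)
    (k0 : 0 < kappa) (x00 : x 0 0 != 0) :
  let y := polyakGD_step gamma (quad kappa) 0 x in
  let s := gamma * (quad kappa x / (kappa ^+ 2 * x 0 0 ^+ 2 + x 0 1 ^+ 2)) in
  y 0 0 = (1 - s * kappa) * x 0 0 /\ y 0 1 = (1 - s) * x 0 1.
Proof.
rewrite /polyakGD_step /polyak_stepsize gradient_quad sqr_enorm.
rewrite !big_ord_recl big_ord0 !mxE /= subr0 addr0 exprMn.
(* The branch where the iteration stays put is impossible: the first entry [kappa * x 0 0] of the
   gradient is nonzero. *)
case: eqP => [/rowP/(_ 0)|_].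
  by rewrite !mxE /= => /eqP; rewrite mulf_eq0 (negPf x00) gt_eqF.
by rewrite !mxE /=; split; ring.
Qed.

Definition slope (R : realType) (gamma kappa : R) : R :=
  (4 * kappa ^+ 2 - gamma * kappa * (kappa + 1)) / (gamma * (kappa + 1) - 4).

Lemma slope_denom_gt0 (R : realType) (gamma kappa : R)
    (hgamma : 0 < gamma < 4)
    (hkappa : Num.max (4 / gamma - 1) (gamma / (4 - gamma)) < kappa) :
  0 < gamma * (kappa + 1) - 4.
Proof.
case/andP: hgamma => g0 _; move: hkappa; rewrite gt_max => /andP[].
by rewrite ltrBlDr ltr_pdivrMr // => h _; lra.
Qed.

Lemma gamma_lt_kappa (R : realType) (gamma kappa : R)
    (hgamma : 0 < gamma < 4)
    (hkappa : Num.max (4 / gamma - 1) (gamma / (4 - gamma)) < kappa) :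
  gamma < kappa * (4 - gamma).
Proof.
case/andP: hgamma => g0 g4; move: hkappa; rewrite gt_max => /andP[_].
by rewrite ltr_pdivrMr // subr_gt0.
Qed.

(** The two bounds inside the maximum read [4 < gamma * (kappa + 1)] and
    [gamma * (kappa + 1) < 4 * kappa]; chaining them gives the claim. *)
Lemma kappa_gt1 (R : realType) (gamma kappa : R)
    (hgamma : 0 < gamma < 4)
    (hkappa : Num.max (4 / gamma - 1) (gamma / (4 - gamma)) < kappa) :
  1 < kappa.
Proof.
have := slope_denom_gt0 hgamma hkappa.
have := gamma_lt_kappa hgamma hkappa; case/andP: hgamma => g0 g4.
by move=> h1 h2; rewrite ltNge; apply/negP => k1; nra.
Qed.

(** Each bound in the maximum gives the sign of one part: the first that of the denominator, the
    second that of the numerator, once [kappa] is factored out. *)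
Lemma slope_gt0 (R : realType) (gamma kappa : R)
    (hgamma : 0 < gamma < 4)
    (hkappa : Num.max (4 / gamma - 1) (gamma / (4 - gamma)) < kappa) :
  0 < slope gamma kappa.
Proof.
apply: divr_gt0; last exact: slope_denom_gt0.
rewrite (_ : _ - _ = kappa * (kappa * (4 - gamma) - gamma)); last by ring.
have k1 := kappa_gt1 hgamma hkappa.
by rewrite mulr_gt0 ?subr_gt0 ?gamma_lt_kappa // (lt_trans ltr01 k1).
Qed.

Lemma polyakGD_step_cone (R : realType) (gamma kappa : R)
    (hgamma : 0 < gamma < 4)
    (hkappa : Num.max (4 / gamma - 1) (gamma / (4 - gamma)) < kappa)
    (x : 'rV[R]_2) (rho := (kappa - 1) / (kappa + 1)) :
  x 0 0 != 0 -> x 0 1 ^+ 2 = slope gamma kappa * x 0 0 ^+ 2 ->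
  let y := polyakGD_step gamma (quad kappa) 0 x in
  y 0 0 = - rho * x 0 0 /\ y 0 1 = rho * x 0 1.
Proof.
move=> x00 hx y; have k1 := kappa_gt1 hgamma hkappa.
have D0 := slope_denom_gt0 hgamma hkappa.
case/andP: hgamma => g0 g4.
have k0 : 0 < kappa by lra.
have [] := polyakGD_step_quad gamma k0 x00; rewrite -/y => -> ->.
(* With the slope substituted, the value of [quad] and the squared gradient norm share the factor
   [kappa * (kappa - 1) * x 0 0 ^+ 2] over the slope denominator. It is nonzero because [kappa > 1]
   and [x 0 0 != 0], so it cancels. *)
have -> : gamma * (quad kappa x / (kappa ^+ 2 * x 0 0 ^+ 2 + x 0 1 ^+ 2)) =
          2 / (kappa + 1).
  have -> : quad kappa x = 2 * kappa * (kappa - 1) * x 0 0 ^+ 2 /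
      (gamma * (kappa + 1) - 4).
    by rewrite /quad hx /slope; field; rewrite gt_eqF.
  have -> : kappa ^+ 2 * x 0 0 ^+ 2 + x 0 1 ^+ 2 =
      gamma * kappa * (kappa + 1) * (kappa - 1) * x 0 0 ^+ 2 /
      (gamma * (kappa + 1) - 4).
    by rewrite hx /slope; field; rewrite gt_eqF.
  by field; rewrite x00 !gt_eqF //; lra.
by rewrite /rho; split; field; rewrite gt_eqF //; lra.
Qed.

Lemma polyakGD_cone (R : realType) (gamma kappa : R)
    (hgamma : 0 < gamma < 4)
    (hkappa : Num.max (4 / gamma - 1) (gamma / (4 - gamma)) < kappa)
    (x0 : 'rV[R]_2) (rho := (kappa - 1) / (kappa + 1)) (k : nat) :
  x0 0 0 != 0 -> x0 0 1 ^+ 2 = slope gamma kappa * x0 0 0 ^+ 2 ->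
  let x := polyakGD gamma (quad kappa) 0 x0 k in
  x 0 0 = (- rho) ^+ k * x0 0 0 /\ x 0 1 = rho ^+ k * x0 0 1.
Proof.
(* The one-step lemma requires a nonzero first coordinate at every iterate, which survives
   multiplication by [- rho] only if [rho != 0]. *)
move=> x00 hx0; have rho0 : rho != 0.
  have k1 := kappa_gt1 hgamma hkappa.
  by rewrite mulf_neq0 ?invr_eq0 ?gt_eqF //; lra.
elim: k => [|k]; first by rewrite !expr0 !mul1r.
rewrite /polyakGD iterS; set x := iter k _ _ => -[e0 e1].
have [||-> ->] := polyakGD_step_cone hgamma hkappa (x := x).
- by rewrite e0 mulf_neq0 // expf_neq0 // oppr_eq0.
(* Squaring removes the sign of [- rho], so both squared coordinates carry the same factor and the
   cone relation persists. *)
- rewrite e0 e1 ![(_ * x0 _ _) ^+ 2]exprMn hx0.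
  by rewrite ![(_ ^+ k) ^+ 2]exprAC sqrrN mulrCA.
- by rewrite e0 e1 !exprS !mulrA.
Qed.

Theorem theorem3p1 (R : realType) (gamma kappa : R) (x0 : 'rV[R]_2)
    (hgamma : 0 < gamma < 4)
    (hkappa : Num.max (4 / gamma - 1) (gamma / (4 - gamma)) < kappa)
    (hx0 : x0 <> 0)
    (hinit : x0 0 1 ^+ 2 =
       (4 * kappa ^+ 2 - gamma * kappa * (kappa + 1)) /
         (gamma * (kappa + 1) - 4) * x0 0 0 ^+ 2) :
  let q := quad kappa in
  let qstar : R := 0 in
  let x := polyakGD gamma q qstar x0 in
  is_min_value q qstar /\
  forall k : nat,
    [/\ `|x k.+1 0 0 / x k 0 0| = (kappa - 1) / (kappa + 1),
        `|x k.+1 0 1 / x k 0 1| = (kappa - 1) / (kappa + 1) &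
        q (x k) - qstar =
          ((kappa - 1) / (kappa + 1)) ^+ (2 * k) * (q x0 - qstar)].
Proof.
move=> q qstar x; have k1 := kappa_gt1 hgamma hkappa.
have k0 : 0 < kappa by lra.
split; first exact/quad_min_value/ltW.
have c0 := slope_gt0 hgamma hkappa.
(* A zero first coordinate would force the second to vanish through [hinit], contradicting [hx0]. *)
have x00 : x0 0 0 != 0.
  apply/eqP => e0; apply: hx0; apply/rowP => i; rewrite mxE.
  move: hinit; rewrite e0 expr0n mulr0 => /eqP; rewrite sqrf_eq0 => /eqP e1.
  case: i => -[|[|//]] p; [rewrite -[RHS]e0 | rewrite -[RHS]e1];
    by congr (x0 _ _); exact: val_inj.
have x01 : x0 0 1 != 0.
  by rewrite -sqrf_eq0 hinit mulf_neq0 ?expf_neq0 // gt_eqF.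
have rho_gt0 : 0 < (kappa - 1) / (kappa + 1) by rewrite divr_gt0 //; lra.
move=> k; have [e0 e1] := polyakGD_cone hgamma hkappa k x00 hinit.
have [f0 f1] := polyakGD_cone hgamma hkappa k.+1 x00 hinit.
move: rho_gt0 e0 e1 f0 f1; set rho := (kappa - 1) / (kappa + 1).
rewrite -/q -/qstar -/x => rho_gt0 e0 e1 f0 f1.
(* These make both denominators nonzero, so the ratios are genuine quotients and not the default
   value of division by zero. *)
have rhoN0 : rho ^+ k != 0 by rewrite expf_neq0 // gt_eqF.
have NrhoN0 : (- rho) ^+ k != 0 by rewrite expf_neq0 // oppr_eq0 gt_eqF.
split.
- rewrite f0 e0 exprS -[_ * _ * x0 0 0]mulrA mulfK ?mulf_neq0 // normrN.
  exact: gtr0_norm.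
- rewrite f1 e1 exprS -[_ * _ * x0 0 1]mulrA mulfK ?mulf_neq0 //.
  exact: gtr0_norm.
(* Only squares of coordinates enter [q], so both terms scale by [rho ^+ (2 * k)]. *)
- rewrite !subr0 /q /quad e0 e1 ![(_ * x0 _ _) ^+ 2]exprMn
    ![(_ ^+ k) ^+ 2]exprAC sqrrN exprM.
  by ring.
Qed.
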